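(* Let $\alpha<\beta$ be real numbers, let $\mathbf{x}=(x_1,\dots,x_l)\in[\alpha,\beta]^l$ and $\mathbf{a}=(a_1,\dots,a_l)\in[0,\infty)^l$ with $\sum_{j=1}^l a_j=1$, and put $\bar{x}=\sum_{j=1}^l a_jx_j$. If $f:[\alpha,\beta]\to\mathbb{R}$ is strongly convex with modulus $c>0$, then $$\sum_{j=1}^{l}a_jf(x_j)\le\frac{\beta-\bar{x}}{\beta-\alpha}f(\alpha)+\frac{\bar{x}-\alpha}{\beta-\alpha}f(\beta)-c\sum_{j=1}^{l}a_j(\beta-x_j)(x_j-\alpha).$$
   Context: A function $f:[\alpha,\beta]\to\mathbb{R}$ is strongly convex with modulus $c>0$ if $f(\lambda x+(1-\lambda)y)\le\lambda f(x)+(1-\lambda)f(y)-c\lambda(1-\lambda)(x-y)^2$ for all $x,y\in[\alpha,\beta]$ and $\lambda\in[0,1]$. *)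

(* Defs.v *)
From mathcomp Require Export all_boot all_order all_algebra.
From mathcomp Require Export reals.

Set Implicit Arguments.
Unset Strict Implicit.
Unset Printing Implicit Defensive.

Import Order.TTheory GRing.Theory Num.Theory.
Local Open Scope ring_scope.

(* A function on [alpha, beta] is represented by a total function on R, of
   which only the values on [alpha, beta] are constrained.  The positivity of
   the modulus c is a separate hypothesis. *)
Definition strongly_convex (R : realType) (alpha beta c : R) (f : R -> R) :=
  forall x y t : R,
    x \in `[alpha, beta] -> y \in `[alpha, beta] -> t \in `[0, 1] ->
    f (t * x + (1 - t) * y)
      <= t * f x + (1 - t) * f y - c * t * (1 - t) * (x - y) ^+ 2.

(* Main.v *)
Require Import Defs.
From mathcomp Require Import ring.

Set Implicit Arguments.
Unset Strict Implicit.
Unset Printing Implicit Defensive.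

Import Order.TTheory GRing.Theory Num.Theory.
Local Open Scope ring_scope.

(** Strong convexity bounds [f z] by the chord of [f] over [[alpha, beta]] minus
    [c * ((beta - z) * (z - alpha))]. The chord is affine in [z], so averaging this bound over the
    points [x j] with weights [a j] of total mass 1 evaluates the chord at [xbar], while the
    quadratic corrections simply add up. *)

(* [z] is the convex combination of [alpha] and [beta] with weight
   [t = (beta - z) / (beta - alpha)] on [alpha], and then
   [t * (1 - t) * (alpha - beta) ^+ 2 = (beta - z) * (z - alpha)]. *)
Lemma strongly_convex_le_chord (R : realType) (alpha beta c z : R) (f : R -> R) :
  alpha < beta -> strongly_convex alpha beta c f -> z \in `[alpha, beta] ->
  f z <= (beta - z) / (beta - alpha) * f alpha
         + (z - alpha) / (beta - alpha) * f beta
         - c * ((beta - z) * (z - alpha)).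
Proof.
move=> ltab f_sc; rewrite in_itv /= => /andP[az zb].
have d_gt0 : 0 < beta - alpha by rewrite subr_gt0.
have d_neq0 : beta - alpha != 0 by rewrite gt_eqF.
have t01 : (beta - z) / (beta - alpha) \in `[0, 1].
  rewrite in_itv /= ler_pdivrMr // mul1r lerD2l lerN2 az andbT.
  by rewrite divr_ge0 ?subr_ge0 // ltW.
have a_in : alpha \in `[alpha, beta] by rewrite in_itv /= lexx ltW.
have b_in : beta \in `[alpha, beta] by rewrite in_itv /= lexx ltW.
have := f_sc _ _ _ a_in b_in t01.
set t := (beta - z) / (beta - alpha).
have -> : t * alpha + (1 - t) * beta = z by rewrite /t; field.
have -> : (z - alpha) / (beta - alpha) = 1 - t by rewrite /t; field.
suff -> : c * t * (1 - t) * (alpha - beta) ^+ 2 = c * ((beta - z) * (z - alpha))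
  by [].
by rewrite /t; field.
Qed.

Theorem theorem1 (R : realType) (alpha beta : R) (l : nat)
    (x a : 'I_l -> R) (c : R) (f : R -> R)
    (lt_alpha_beta : alpha < beta)
    (x_in : forall j, x j \in `[alpha, beta])
    (a_ge0 : forall j, 0 <= a j)
    (sum_a : \sum_(j < l) a j = 1)
    (c_gt0 : 0 < c)
    (f_sc : strongly_convex alpha beta c f) :
  let xbar := \sum_(j < l) a j * x j in
  \sum_(j < l) a j * f (x j)
    <= (beta - xbar) / (beta - alpha) * f alpha
       + (xbar - alpha) / (beta - alpha) * f beta
       - c * \sum_(j < l) a j * (beta - x j) * (x j - alpha).
Proof.
cbv zeta; set xbar := \sum_(j < l) a j * x j.
(* As the weights sum to 1, [beta] is the weighted mean of the constant [beta]; likewise for [alpha]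
   below. *)
have -> : beta - xbar = \sum_(j < l) a j * (beta - x j).
  rewrite -[beta in LHS]mul1r -sum_a mulr_suml -sumrB.
  by apply: eq_bigr => j _; rewrite mulrBr.
have -> : xbar - alpha = \sum_(j < l) a j * (x j - alpha).
  rewrite -[alpha in LHS]mul1r -sum_a mulr_suml -sumrB.
  by apply: eq_bigr => j _; rewrite mulrBr.
(* The right-hand side becomes one sum over [j], so the comparison can be made term by term. *)
rewrite !mulr_suml mulr_sumr -big_split -sumrB /=.
apply: ler_sum => j _.
have := strongly_convex_le_chord lt_alpha_beta f_sc (x_in j).
move=> /(ler_wpM2l (a_ge0 j)) /le_trans; apply.
(* What remains is an equality: [a j] distributed over the chord bound at [x j]. *)
by rewrite le_eqVlt; apply/orP; left; apply/eqP; ring.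
Qed.
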